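(* Let $G$ be a finite, simple, undirected graph with $n$ vertices, average degree $d$, and degree deviation $s$ with $s>0$. Let $\lambda(G)$ be the spectral radius of $G$ and let $\tilde{\lambda}(G)$ be the largest eigenvalue of the smoothed adjacency matrix $\tilde{A}$ of $G$. Then $$\lambda(G)\geq\tilde{\lambda}(G)\geq \begin{cases} \frac{d^2n}{\sqrt{d^2n^2-s^2}} & \text{if } s\leq \frac{dn}{\sqrt{2}},\\[2mm] \frac{2s}{n} & \text{if } s> \frac{dn}{\sqrt{2}}. \end{cases}$$
   Context: Let $G$ have vertex set $V$, $n$ vertices, $m$ edges and average degree $d=\frac{2m}{n}$. The degree deviation is $s=s(G)=\sum_{u\in V}|d_G(u)-d|$. The spectral radius $\lambda(G)$ is the largest eigenvalue of the adjacency matrix of $G$. Smoothed adjacency matrix: Let $V_+=\{u\in V: d_G(u)>d\}$, $V_-=\{u\in V: d_G(u)\leq d\}$, $n_+=|V_+|$, $n_-=|V_-|$. Let $m_+$ and $m_-$ be the numbers of edges of the induced subgraphs $G[V_+]$ and $G[V_-]$, respectively, and let $m_{\pm}=m-(m_++m_-)$. Let $w_+=m_+/\binom{n_+}{2}$, $w_-=m_-/\binom{n_-}{2}$, $w_{\pm}=m_{\pm}/(n_+n_-)$, where a quotient with denominator $0$ is set to $0$. The matrix $\tilde{A}=(\tilde{a}_{u,v})_{u,v\in V}$ is the symmetric matrix with $\tilde{a}_{u,v}=w_+$ if $u,v\in V_+$ and $u\neq v$; $\tilde{a}_{u,v}=w_-$ if $u,v\in V_-$ and $u\neq v$; $\tilde{a}_{u,v}=w_{\pm}$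 if exactly one of $u,v$ lies in $V_+$; and $\tilde{a}_{u,u}=0$. Then $\tilde{\lambda}(G)$ is the largest eigenvalue of $\tilde{A}$. *)

(* Defs.v *)
From HB Require Import structures.
From mathcomp Require Import all_boot all_order all_algebra.
From mathcomp Require Import complex polyrcf.
From mathcomp Require Import all_classical all_reals.

Set Implicit Arguments.
Unset Strict Implicit.
Unset Printing Implicit Defensive.

Import Order.TTheory GRing.Theory Num.Theory.

Local Open Scope ring_scope.

Section Eigenvalues.
Variable R : realType.

Definition is_largest_eigenvalue n (A : 'M[R]_n) (a : R) : Prop :=
  eigenvalue A a /\ (forall b, eigenvalue A b -> b <= a).

(* The value is 0 when A has no real eigenvalue. That does not happen for a
   symmetric matrix of positive size: see [largest_eigenvalueP]. *)
Definition largest_eigenvalue n (A : 'M[R]_n) : R :=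
  xget 0 [set a | is_largest_eigenvalue A a]%classic.

Lemma symmetric_eigenvalue_ex n (A : 'M[R]_n) :
  (0 < n)%N -> A^T = A -> exists a, eigenvalue A a.
Proof.
move=> n_gt0 Asym; pose f := real_complex R.
have [z rz] : exists z : R[i], root (char_poly (map_mx f A)) z.
  by apply/closed_rootP; rewrite size_char_poly eqSS -lt0n.
have /eigenvalueP[v vA vN0] : eigenvalue (map_mx f A) z.
  by rewrite eigenvalue_root_char.
pose w := map_mx (@conjc R) v.
have fsym : (map_mx f A)^T = map_mx f A by apply/matrixP => i j; rewrite !mxE -[in LHS]Asym mxE.
have wA : w *m map_mx f A = conjc z *: w.
  have -> : map_mx f A = map_mx (@conjc R) (map_mx f A).
    by apply/matrixP => i j; rewrite !mxE /= oppr0.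
  by rewrite -map_mxM vA map_mxZ.
have vw_neq0 : (v *m w^T) 0 0 != 0.
  apply: contra_neq vN0; rewrite mxE => /eqP; rewrite psumr_eq0; last first.
    by move=> i _; rewrite !mxE -sqr_normc exprn_ge0.
  move=> /allP h; apply/rowP => i; have := h i (mem_index_enum _).
  rewrite !mxE -sqr_normc => /implyP/(_ isT).
  by rewrite sqrf_eq0 normr_eq0 => /eqP.
have zE : z = conjc z.
  apply: (mulIf vw_neq0).
  have e1 : (v *m map_mx f A *m w^T) 0 0 = z * (v *m w^T) 0 0.
    by rewrite vA -scalemxAl mxE.
  have e2 : (v *m map_mx f A *m w^T) 0 0 = conjc z * (v *m w^T) 0 0.
    by rewrite -mulmxA -[X in X *m w^T]fsym -trmx_mul wA linearZ -scalemxAr mxE.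
  by rewrite -e1.
have zR : z = f (complex.Re z).
  case: z zE {rz vA wA} => a b /= [] /eqP.
  by rewrite -subr_eq0 opprK -mulr2n mulrn_eq0 /= => /eqP ->.
exists (complex.Re z); rewrite -(eigenvalue_map (real_complex R)) /=.
by rewrite [X in eigenvalue _ X](_ : _ = z) ?eigenvalue_root_char.
Qed.

Lemma largest_eigenvalueP n (A : 'M[R]_n) :
  (0 < n)%N -> A^T = A -> is_largest_eigenvalue A (largest_eigenvalue A).
Proof.
move=> n_gt0 /(symmetric_eigenvalue_ex n_gt0)[a0 a0A].
apply: (xgetPex 0 (P := [set a | is_largest_eigenvalue A a]%classic)).
have pN0 : char_poly A != 0 by rewrite -size_poly_eq0 size_char_poly.
pose rs := rootsR (char_poly A).
have rsE b : (b \in rs) = eigenvalue A b.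
  by rewrite -(roots_on_rootsR pN0) eigenvalue_root_char.
pose M := \big[Order.max/a0]_(b <- rs) b.
exists M; split; last by move=> b; rewrite -rsE => /le_bigmax_seq; apply.
rewrite /M big_seq; elim/big_ind: _ => //.
  by move=> x y Ax Ay; case: leP.
by move=> b; rewrite rsE.
Qed.

Lemma largest_eigenvalue_unique n (A : 'M[R]_n) a :
  is_largest_eigenvalue A a -> largest_eigenvalue A = a.
Proof.
move=> Aa; apply: xget_unique => // b [Ab bmax]; apply/eqP.
by rewrite eq_le; case: Aa => Aa amax; rewrite amax //= bmax.
Qed.

End Eigenvalues.

Section Graph.
Variables (R : realType) (V : finType) (E : rel V).

Definition edges : {set {set V}} :=
  [set A | [exists u, exists v, E u v && (A == [set u; v])]].

(* Number of edges of the subgraph induced by S. *)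
Definition edges_in (S : {set V}) : nat := #|[set A in edges | A \subset S]|.

Definition degree (u : V) : nat := #|[set v | E u v]|.

Definition avg_degree : R := 2 * #|edges|%:R / #|V|%:R.

Definition degree_deviation : R := \sum_(u : V) `|(degree u)%:R - avg_degree|.

(* The matrix with entries a u v; rows and columns are listed in the order of
   [enum V]. *)
Definition mx_of (a : V -> V -> R) : 'M[R]_#|V| :=
  \matrix_(i < #|V|, j < #|V|) a (enum_val i) (enum_val j).

Definition adjacency_mx : 'M[R]_#|V| := mx_of (fun u v => (E u v)%:R).

Definition spectral_radius : R := largest_eigenvalue adjacency_mx.

Definition Vplus : {set V} := [set u | (degree u)%:R > avg_degree].
Definition Vminus : {set V} := [set u | (degree u)%:R <= avg_degree].

Definition m_cross : R := #|edges|%:R - ((edges_in Vplus)%:R + (edges_in Vminus)%:R).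

(* In all three densities a quotient with denominator 0 is 0, since 0^-1 = 0. *)
Definition w_plus : R := (edges_in Vplus)%:R / 'C(#|Vplus|, 2)%:R.
Definition w_minus : R := (edges_in Vminus)%:R / 'C(#|Vminus|, 2)%:R.
Definition w_cross : R := m_cross / (#|Vplus|%:R * #|Vminus|%:R).

Definition smoothed_entry (u v : V) : R :=
  if u == v then 0
  else if (u \in Vplus) && (v \in Vplus) then w_plus
  else if (u \in Vminus) && (v \in Vminus) then w_minus
  else w_cross.

Definition smoothed_mx : 'M[R]_#|V| := mx_of smoothed_entry.

Definition smoothed_radius : R := largest_eigenvalue smoothed_mx.

End Graph.

(* Main.v *)
(* By the spectral theorem the largest eigenvalue is the maximum of the Rayleigh
   quotient. On vectors that are constant on V_+ and on V_- the quadratic forms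
   of A and of its smoothing agree, and replacing a vector by its averages over
   the two classes does not decrease the smoothed form and does not increase the
   norm; hence the first inequality.
   For the second one, a vector with value a on V_+ and b on V_- has the form
   (s/2) (a^2 - b^2) + d (n_+ a^2 + n_- b^2) - m_{+-} (a - b)^2,
   because the degree deviation is equally shared by V_+ and V_-. It decreases
   with m_{+-}, which is at most d n_- - s/2 and d n_+ + s/2 since m_- and m_+ are
   nonnegative. At one of these two values a 2x2 determinant condition
   yields a and b whose Rayleigh quotient reaches the bound. *)

Require Import Defs.
From mathcomp Require Import all_boot all_order all_algebra.
From mathcomp Require Import complex ring lra zify.
From mathcomp Require Import all_classical all_reals.

Set Implicit Arguments.
Unset Strict Implicit.
Unset Printing Implicit Defensive.

Import Order.TTheory GRing.Theory Num.Theory.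
Local Open Scope ring_scope.
Local Open Scope sesquilinear_scope.

(** * The Rayleigh bound for real symmetric matrices *)

(** Over the complex numbers [A] is Hermitian, hence unitarily diagonalizable. In an eigenbasis its
    form is a sum of squared moduli weighted by eigenvalues, all of which are real eigenvalues of
    [A]. *)
Lemma rayleigh_le (R : realType) n (A : 'M[R]_n) (x : 'rV[R]_n) :
    (0 < n)%N -> A^T = A ->
  (x *m A *m x^T) 0 0 <= largest_eigenvalue A * (x *m x^T) 0 0.
Proof.
move=> n_gt0 Asym; have [_ lamax] := largest_eigenvalueP n_gt0 Asym.
pose f := real_complex R; pose Ac := map_mx f A; pose xc := map_mx f x.
have conjf (m p : nat) (B : 'M[R]_(m, p)) : map_mx Num.conj (map_mx f B) = map_mx f B.
  by apply/matrixP => i j; rewrite !mxE; apply/CrealP; rewrite complex_real.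
have fE (B : 'M[R]_1) : f (B 0 0) = (map_mx f B) 0 0 by rewrite mxE.
have Aherm : Ac \is hermsymmx.
  apply: realsym_hermsym.
    by apply/is_hermitianmxP; rewrite expr0 scale1r map_mx_id // /Ac map_trmx Asym.
  by apply/mxOverP => i j; rewrite mxE complex_real.
have /orthomx_spectralP := hermitian_normalmx Aherm.
set P := spectralmx Ac; set sp := spectral_diag Ac => AcE.
have Pu : P \is unitarymx := spectral_unitarymx Ac.
have PPi : P *m invmx P = 1%:M by rewrite mulmxV ?unitarymx_unit.
have spP i : exists2 b, sp 0 i = f b & b <= largest_eigenvalue A.
  have := hermitian_spectral_diag_real Aherm => /mxOverP /(_ 0 i) /complex_realP[b bE].
  exists b => //; apply: lamax; rewrite -(eigenvalue_map f); apply/eigenvalueP.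
  (* This is row [i] of [P], an eigenvector for [sp 0 i]; it is nonzero because [P] is
     invertible. *)
  exists (delta_mx 0 i *m P); last first.
    apply/eqP => /(congr1 (mulmx^~ (invmx P))); rewrite -mulmxA PPi mulmx1 mul0mx.
    by move=> /rowP/(_ i); rewrite !mxE !eqxx => /eqP; rewrite oner_eq0.
  rewrite -/Ac AcE !mulmxA -(mulmxA _ P) PPi mulmx1 -(rowE i (diag_mx sp)).
  by rewrite row_diag_mx -scalemxAl -/sp bE.
pose y := xc *m P^t*.
have yE : y^t* = P *m xc^T.
  rewrite /y trmx_mul map_mxM /= trmxCK.
  by rewrite /xc map_trmx conjf.
have e1 : f ((x *m A *m x^T) 0 0) = \sum_i `|y 0 i| ^+ 2 * sp 0 i.
  transitivity ((y *m diag_mx sp *m y^t*) 0 0).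
    rewrite yE /y -(invmx_unitary Pu) !mulmxA -(mulmxA xc) -(mulmxA xc) -AcE.
    by rewrite fE !map_mxM map_trmx.
  rewrite mxE; apply: eq_bigr => i _.
  by rewrite mul_mx_diag !mxE normCK mulrAC.
have e2 : f ((x *m x^T) 0 0) = \sum_i `|y 0 i| ^+ 2.
  transitivity ((y *m y^t*) 0 0).
    rewrite yE /y -(invmx_unitary Pu) mulmxA -(mulmxA xc) mulVmx ?unitarymx_unit //.
    by rewrite fE map_mxM mulmx1 map_trmx.
  by rewrite mxE; apply: eq_bigr => i _; rewrite !mxE normCK.
suff : f ((x *m A *m x^T) 0 0) <= f (largest_eigenvalue A * (x *m x^T) 0 0).
  by rewrite lecR.
rewrite [leRHS]rmorphM [X in _ * X]e2 e1 mulr_sumr.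
apply: ler_sum => i _; rewrite mulrC; have [b -> bla] := spP i.
by rewrite ler_wpM2r ?exprn_ge0 // lecR.
Qed.

(** * Binary quadratic forms and the two-class bounds *)

(** For [X < 0] the vector [(- c, X)] gives the form the value [X * (X * Y - c ^+ 2)], a product of
    two nonpositive numbers. *)
Lemma binary_form_nonneg_vector (R : realFieldType) (X Y c : R) :
    X * Y <= c ^+ 2 ->
  exists a b : R, (a != 0) || (b != 0) /\
    0 <= X * a ^+ 2 + 2 * c * a * b + Y * b ^+ 2.
Proof.
move=> XY; have [X0 | X0] := leP 0 X.
  by exists 1, 0; rewrite oner_neq0; split => //; nra.
exists (- c), X; rewrite (ltr0_neq0 X0) orbT; split => //.
rewrite [leRHS](_ : _ = X * (X * Y - c ^+ 2)); last by ring.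
by rewrite mulr_le0 ?subr_le0 // ltW.
Qed.

(* c0 may replace c since the form is nonincreasing in c: the terms in c add up
   to - c (a - b)^2. *)
Lemma two_block_vector (R : realFieldType) (d S p q c c0 mu : R) :
    0 < p -> 0 < q -> c <= c0 ->
    (S + (d - mu) * q - c0) * ((d - mu) * p - S - c0) <= c0 ^+ 2 ->
  exists a b : R, 0 < q * a ^+ 2 + p * b ^+ 2 /\
    mu * (q * a ^+ 2 + p * b ^+ 2) <=
    (S + d * q - c) * a ^+ 2 + (d * p - S - c) * b ^+ 2 + 2 * c * a * b.
Proof.
move=> p0 q0 cc0 /binary_form_nonneg_vector[a [b [ab form_ge0]]].
exists a, b; split.
  have [a0 | a0] := eqVneq a 0.
    rewrite a0 eqxx /= in ab *; rewrite expr0n mulr0 add0r.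
    by rewrite pmulr_rgt0 // exprn_even_gt0.
  apply: ltr_pwDl; first by rewrite pmulr_rgt0 // exprn_even_gt0.
  by rewrite mulr_ge0 ?sqr_ge0 ?ltW.
have : 0 <= (c0 - c) * (a - b) ^+ 2 by rewrite mulr_ge0 ?sqr_ge0 ?subr_ge0.
by move: form_ge0; lra.
Qed.

(* In the application p and q are the sizes of V_- and V_+, s = 2 S is the degree
   deviation and c = m_{+-}; then 2 m_+ = S + d q - c and 2 m_- = d p - S - c, so
   cp and cq say that m_- and m_+ are nonnegative. *)
Section TwoBlocks.
Variables (R : rcfType) (d S p q c n s : R).
Hypotheses (p0 : 0 < p) (q0 : 0 < q) (S0 : 0 < S) (c0 : 0 <= c).
Hypotheses (cp : c <= d * p - S) (cq : c <= S + d * q).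
Hypotheses (nE : n = p + q) (sE : s = 2 * S).

(** With [c0 = d * p - S], the relation [mu * n = 4 * S] turns the gap in the determinant condition
    into the square of [(mu - d) * p - S]. *)
Lemma two_block_large :
  exists a b : R, 0 < q * a ^+ 2 + p * b ^+ 2 /\
    2 * s / n * (q * a ^+ 2 + p * b ^+ 2) <=
    (S + d * q - c) * a ^+ 2 + (d * p - S - c) * b ^+ 2 + 2 * c * a * b.
Proof.
have n0 : n != 0 by rewrite nE gt_eqF ?addr_gt0.
set mu := 2 * s / n; apply: two_block_vector cp _ => //.
have muq : mu * q = 4 * S - mu * p.
  by apply/eqP; rewrite eq_sym subr_eq -mulrDr addrC -nE mulfVK // sE; apply/eqP; ring.
rewrite -subr_ge0 [leRHS](_ : _ = ((mu - d) * p - S) ^+ 2) ?sqr_ge0 //.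
ring: muq.
Qed.

Lemma two_block_small :
  s <= d * n / Num.sqrt 2 ->
  exists a b : R, 0 < q * a ^+ 2 + p * b ^+ 2 /\
    d ^+ 2 * n / Num.sqrt (d ^+ 2 * n ^+ 2 - s ^+ 2) * (q * a ^+ 2 + p * b ^+ 2) <=
    (S + d * q - c) * a ^+ 2 + (d * p - S - c) * b ^+ 2 + 2 * c * a * b.
Proof.
have n0 : 0 < n by rewrite nE addr_gt0.
have d0 : 0 < d by rewrite -(pmulr_lgt0 _ p0); move: S0 c0 cp; lra.
have s0 : 0 < s by rewrite sE mulr_gt0.
have dn0 : 0 < d * n by rewrite mulr_gt0.
rewrite ler_pdivlMr ?sqrtr_gt0 // -ler_sqr ?nnegrE ?mulr_ge0 ?sqrtr_ge0
  ?(ltW s0) ?(ltW d0) ?(ltW n0) //.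
rewrite exprMn sqr_sqrtr // => s_le.
set g := Num.sqrt _.
have g2 : g ^+ 2 = d ^+ 2 * n ^+ 2 - s ^+ 2.
  by rewrite sqr_sqrtr // subr_ge0; have := sqr_ge0 s; move: s_le; rewrite -exprMn; lra.
have g_ge0 : 0 <= g by rewrite sqrtr_ge0.
(* The threshold on [s] enters here: squared, it reads [2 * s ^+ 2 <= d ^+ 2 * n ^+ 2]. *)
have sg : s <= g.
  by rewrite -ler_sqr ?nnegrE ?(ltW s0) // g2 -exprMn; lra.
have g0 : 0 < g := lt_le_trans s0 sg.
have gdn : g <= d * n.
  by rewrite -ler_sqr ?nnegrE ?(ltW dn0) // g2 (exprMn _ d) gerBl sqr_ge0.
set mu := _ / g; have muE : mu * g = d ^+ 2 * n by rewrite /mu mulfVK ?gt_eqF.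
have mu0 : 0 < mu by rewrite divr_gt0 // mulr_gt0 // exprn_gt0.
have mud : d <= mu by rewrite ler_pdivlMr // expr2 -mulrA ler_pM2l.
have mus : mu * s <= d ^+ 2 * n by rewrite -muE ler_pM2l.
(* mu is chosen so that (mu - d) (dn +- s) / (2d) and (mu + d) (dn -+ s) / (2d)
   have product S^2, which makes the determinants below factor. *)
have mu2 : (mu ^+ 2 - d ^+ 2) * (d ^+ 2 * n ^+ 2 - s ^+ 2) = d ^+ 2 * s ^+ 2.
  by rewrite -g2 mulrBl -exprMn muE g2; ring.
(* The smaller upper bound on [c] becomes [c0]. The comparison of the two bounds is what makes the
   first factor of the product below nonpositive. *)
have [cpq | cqp] := leP (d * p - S) (S + d * q).
  apply: two_block_vector cp _ => //.
  have : 0 <= (2 * d * ((mu - d) * p) - (mu - d) * (d * n + s)) *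
              (2 * d * ((mu - d) * p) - (mu + d) * (d * n - s)).
    have le1 : 2 * d * ((mu - d) * p) - (mu - d) * (d * n + s) <= 0.
      rewrite [leLHS](_ : _ = (mu - d) * (2 * (d * p) - d * n - s)); last by ring.
      by rewrite mulr_ge0_le0 ?subr_ge0 // nE sE; lra.
    (* The second factor is the first plus [2 * (mu * s - d ^+ 2 * n)], which [mus] makes
       nonpositive. *)
    by rewrite mulr_le0 //; lra.
  rewrite [leRHS](_ : _ = 4 * d ^+ 2 * ((d * p - S) ^+ 2 -
      (S + (d - mu) * q - (d * p - S)) * ((d - mu) * p - S - (d * p - S)))).
    by rewrite pmulr_rge0 ?subr_ge0 // mulr_gt0 // exprn_gt0.
  by move: mu2; rewrite nE sE; lra.
apply: two_block_vector cq _ => //.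
have : 0 <= (2 * d * ((mu - d) * q) - (mu - d) * (d * n - s)) *
            (2 * d * ((mu - d) * q) - (mu + d) * (d * n + s)).
  have le1 : 2 * d * ((mu - d) * q) - (mu - d) * (d * n - s) <= 0.
    rewrite [leLHS](_ : _ = (mu - d) * (2 * (d * q) - d * n + s)); last by ring.
    by rewrite mulr_ge0_le0 ?subr_ge0 // nE sE; lra.
  rewrite mulr_le0 //.
  have := mulr_gt0 mu0 s0; have := mulr_gt0 d0 dn0; lra.
rewrite [leRHS](_ : _ = 4 * d ^+ 2 * ((S + d * q) ^+ 2 -
    (S + (d - mu) * q - (S + d * q)) * ((d - mu) * p - S - (S + d * q)))).
  by rewrite pmulr_rge0 ?subr_ge0 // mulr_gt0 // exprn_gt0.
by move: mu2; rewrite nE sE; lra.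
Qed.
End TwoBlocks.

(** * Quadratic forms indexed by vertices *)

(** Indexing by [V] instead of ordinals lets the sums be split along vertex classes. *)
Definition quadratic_form (R : realType) (V : finType)
    (a : V -> V -> R) (x : V -> R) : R :=
  \sum_u \sum_v x u * a u v * x v.

Section WeightedGraph.
Variables (R : realType) (V : finType) (a : V -> V -> R).
Hypotheses (V_gt0 : (0 < #|V|)%N) (asym : forall u v, a u v = a v u).

Lemma tr_mx_of : (mx_of a)^T = mx_of a.
Proof. by apply/matrixP => i j; rewrite !mxE asym. Qed.

Lemma sum_enum_val (F : V -> R) : \sum_(i < #|V|) F (enum_val i) = \sum_u F u.
Proof. by rewrite [RHS](big_enum_val (A := {: V}) F). Qed.

Lemma quadratic_formE (x : 'rV[R]_#|V|) :
  (x *m mx_of a *m x^T) 0 0 = quadratic_form a (fun u => x 0 (enum_rank u)).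
Proof.
rewrite mxE /quadratic_form exchange_big -sum_enum_val; apply: eq_bigr => j _.
rewrite !mxE enum_valK mulr_suml -sum_enum_val; apply: eq_bigr => i _.
by rewrite mxE enum_valK.
Qed.

Lemma sqr_normE (x : 'rV[R]_#|V|) : (x *m x^T) 0 0 = \sum_u x 0 (enum_rank u) ^+ 2.
Proof.
by rewrite mxE -sum_enum_val; apply: eq_bigr => i _; rewrite mxE enum_valK expr2.
Qed.

Lemma quadratic_form_le (x : V -> R) :
  quadratic_form a x <= largest_eigenvalue (mx_of a) * \sum_u x u ^+ 2.
Proof.
have := rayleigh_le (\row_i x (enum_val i)) V_gt0 tr_mx_of.
rewrite quadratic_formE sqr_normE; congr (_ <= _ * _).
  by do 2![apply: eq_bigr => ? _]; rewrite !mxE !enum_rankK.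
by apply: eq_bigr => ? _; rewrite !mxE !enum_rankK.
Qed.

(** An eigenvector for the largest eigenvalue attains the bound of [quadratic_form_le]. *)
Lemma quadratic_form_max : exists2 x : V -> R, 0 < \sum_u x u ^+ 2 &
  quadratic_form a x = largest_eigenvalue (mx_of a) * \sum_u x u ^+ 2.
Proof.
have [/eigenvalueP[x xA x0] _] := largest_eigenvalueP V_gt0 tr_mx_of.
exists (fun u => x 0 (enum_rank u)); last first.
  by rewrite -quadratic_formE xA -scalemxAl mxE sqr_normE.
have [i xi0] : exists i, x 0 i != 0 by apply/rV0Pn.
rewrite (bigD1 (enum_val i)) //= enum_valK ltr_pwDl ?sumr_ge0 //.
  by rewrite exprn_even_gt0.
by move=> ? _; rewrite sqr_ge0.
Qed.
End WeightedGraph.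

(** * Counting edges by ordered pairs *)

Section Edges.
Variables (V : finType) (E : rel V).
Hypotheses (Esym : symmetric E) (Eirr : irreflexive E).

(** Ordered pairs are counted: for symmetric [E], an edge joining two vertices of [S :&: T] counts
    twice, an edge between disjoint [S] and [T] once. *)
Definition arcs (S T : {set V}) : nat := (\sum_(u in S) \sum_(v in T) E u v)%N.

Lemma arcsC S T : arcs S T = arcs T S.
Proof. by rewrite /arcs exchange_big; do 2![apply: eq_bigr => ? _]; rewrite Esym. Qed.

Lemma edges_card2 e : e \in edges E -> #|e| = 2%N.
Proof.
rewrite inE => /existsP[u /existsP[v /andP[uv /eqP ->]]].
by rewrite cards2; case: eqP uv => // ->; rewrite Eirr.
Qed.

Lemma mem_edges u v : ([set u; v] \in edges E) = E u v.
Proof.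
rewrite inE; apply/existsP/idP => [[u' /existsP[v' /andP[uv' /eqP eqS]]] | uv]; last first.
  by exists u; apply/existsP; exists v; rewrite uv eqxx.
have uv : u != v.
  apply/eqP => uv; have: #|[set u'; v']| = 2%N.
    apply: edges_card2; rewrite inE; apply/existsP; exists u'.
    by apply/existsP; exists v'; rewrite uv' eqxx.
  by rewrite -eqS uv cards2 eqxx.
have : u \in [set u'; v'] by rewrite -eqS finset.set21.
have : v \in [set u'; v'] by rewrite -eqS finset.set22.
rewrite !inE => /orP[] /eqP vE /orP[] /eqP uE; move: uv uv'; rewrite vE uE ?eqxx //.
by rewrite Esym.
Qed.

(** The map sending an arc to its set of endpoints has fibres of exactly two elements, since there
    are no loops. *)
Lemma arcs_diag S : arcs S S = (2 * edges_in E S)%N.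
Proof.
rewrite /arcs pair_big /= /edges_in.
transitivity (\sum_(p : V * V | [&& p.1 \in S, p.2 \in S & E p.1 p.2]) 1)%N.
  rewrite big_mkcond [RHS]big_mkcond; apply: eq_bigr => -[u v] _ /=.
  by case: (u \in S); case: (v \in S); case: (E u v).
rewrite (partition_big (fun p => [set p.1; p.2])
    (fun e => e \in [set A in edges E | A \subset S])) /=; last first.
  move=> [u v] /and3P[/= uS vS uv]; rewrite inE mem_edges uv.
  by rewrite finset.subUset !finset.sub1set uS.
rewrite mulnC -sum_nat_const; apply: eq_bigr => e.
rewrite inE => /andP[eE eS]; have /eqP/cards2P[u [v [uv eE2]]] := edges_card2 eE.
rewrite eE2 finset.subUset !finset.sub1set in eS; case/andP: eS => uS vS.
rewrite eE2 mem_edges in eE.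
rewrite sum1_card (_ : #|_| = #|[set (u, v); (v, u)]|); last first.
  apply: eq_card => -[x y]; rewrite !inE unfold_in /= eE2.
  apply/andP/idP => [[_ /eqP eqS] | /orP[] /eqP[-> ->]]; last 2 first.
  - by rewrite uS vS eE.
  - by rewrite uS vS Esym eE finset.setUC.
  have : u \in [set x; y] by rewrite eqS finset.set21.
  have : v \in [set x; y] by rewrite eqS finset.set22.
  rewrite !inE !xpair_eqE => /orP[] /eqP vE /orP[] /eqP uE; move: uv.
  - by rewrite uE vE eqxx.
  - by rewrite -uE -vE !eqxx orbT.
  - by rewrite -uE -vE !eqxx.
  - by rewrite uE vE eqxx.
by rewrite cards2 xpair_eqE negb_and uv.
Qed.

Lemma edges_in_le S : (edges_in E S <= 'C(#|S|, 2))%N.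
Proof.
rewrite -cards_draws; apply/subset_leq_card/fintype.subsetP => e.
rewrite inE => /andP[eE eS]; rewrite inE eS /=.
by apply/eqP/edges_card2.
Qed.

Lemma edges_in_setT : edges_in E [set: V] = #|edges E|.
Proof. by apply: eq_card => e; rewrite inE finset.subsetT andbT. Qed.

Lemma arcs_splitr S T : arcs S [set: V] = (arcs S T + arcs S (~: T))%N.
Proof.
rewrite /arcs -big_split; apply: eq_bigr => u _ /=.
rewrite (bigID (mem T)) /=; congr (_ + _)%N; apply: eq_bigl => v; by rewrite !inE.
Qed.

Lemma arcs_setT S : arcs S [set: V] = (\sum_(u in S) degree E u)%N.
Proof.
apply: eq_bigr => u _; rewrite /degree -sum1_card [RHS]big_mkcond [LHS]big_mkcond.
by apply: eq_bigr => v _; rewrite !inE; case: (E u v).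
Qed.
End Edges.

(** * Sums over one vertex class *)

Lemma double_sum_offdiag (R : realType) (V : finType) (S : {set V}) (w : R) (x : V -> R) :
  \sum_(u in S) \sum_(v in S) x u * (if u == v then 0 else w) * x v =
  w * ((\sum_(u in S) x u) ^+ 2 - \sum_(u in S) x u ^+ 2).
Proof.
rewrite mulrBr expr2 mulr_suml !mulr_sumr -sumrB; apply: eq_bigr => u uS.
rewrite mulr_sumr (bigD1 u) //= [in RHS](bigD1 u) //= eqxx mulr0 mul0r add0r.
rewrite mulrDr expr2 addrAC subrr add0r mulr_sumr; apply: eq_bigr => v /andP[_ uv].
by rewrite eq_sym (negPf uv) mulrCA mulrA.
Qed.

(** Cauchy-Schwarz, obtained by expanding the squared deviations from the mean. *)
Lemma sqr_sum_le (R : realType) (V : finType) (S : {set V}) (x : V -> R) :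
  (\sum_(u in S) x u) ^+ 2 / #|S|%:R <= \sum_(u in S) x u ^+ 2.
Proof.
have [->|/set0Pn[u0 u0S]] := eqVneq S finset.set0.
  by rewrite !big_set0 expr0n mul0r.
have S0 : 0 < #|S|%:R :> R by rewrite ltr0n; apply/card_gt0P; exists u0.
set q := _%:R in S0 *; set t := \sum_(u in S) x u.
have : 0 <= \sum_(u in S) (x u - t / q) ^+ 2 by apply: sumr_ge0 => u _; rewrite sqr_ge0.
rewrite (eq_bigr (fun u => x u ^+ 2 - 2 * (t / q) * x u + (t / q) ^+ 2)); last first.
  by move=> u _; ring.
rewrite big_split sumrB /= -mulr_sumr sumr_const -(mulr_natr _ #|S|) -/q -/t.
have -> : 2 * (t / q) * t = 2 * (t ^+ 2 / q) by ring.
have -> : (t / q) ^+ 2 * q = t ^+ 2 / q by field; rewrite gt_eqF.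
lra.
Qed.

Lemma sum_expr_const (R : realType) (V : finType) (S : {set V}) (x : V -> R) e k :
  {in S, forall u, x u = e} -> \sum_(u in S) x u ^+ k = #|S|%:R * e ^+ k.
Proof.
by move=> xe; rewrite (eq_bigr (fun=> e ^+ k)) => [|u /xe -> //]; rewrite sumr_const mulr_natl.
Qed.

(** * The smoothed matrix and the degree deviation *)

Section Smoothed.
Variables (R : realType) (V : finType) (E : rel V).
Hypotheses (Esym : symmetric E) (Eirr : irreflexive E).
Local Notation Vp := (Vplus R E).
Local Notation Vm := (Vminus R E).
Local Notation d := (avg_degree R E).
Local Notation s := (degree_deviation R E).

Lemma Vminus_setC : Vm = ~: Vp.
Proof. by apply/setP => u; rewrite !inE leNgt. Qed.

Lemma sum_Vplus_Vminus (F : V -> R) :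
  \sum_u F u = \sum_(u in Vp) F u + \sum_(u in Vm) F u.
Proof.
rewrite (bigID (mem Vp)) /=; congr (_ + _).
by rewrite Vminus_setC; apply: eq_bigl => u; rewrite [in RHS]inE.
Qed.

Lemma card_Vplus_Vminus : #|V|%:R = #|Vp|%:R + #|Vm|%:R :> R.
Proof. by rewrite -natrD Vminus_setC cardsC. Qed.

Lemma smoothed_entryC u v : smoothed_entry R E u v = smoothed_entry R E v u.
Proof. by rewrite /smoothed_entry eq_sym andbC [(u \in Vm) && _]andbC. Qed.

(** Only class sums and class sums of squares matter; the squares are subtracted because the
    diagonal is zero. *)
Lemma smoothed_formE (x : V -> R) :
  quadratic_form (smoothed_entry R E) x =
  w_plus R E * ((\sum_(u in Vp) x u) ^+ 2 - \sum_(u in Vp) x u ^+ 2) +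
  w_minus R E * ((\sum_(u in Vm) x u) ^+ 2 - \sum_(u in Vm) x u ^+ 2) +
  2 * w_cross R E * (\sum_(u in Vp) x u) * (\sum_(u in Vm) x u).
Proof.
have pm u : u \in Vm -> (u \in Vp) = false.
  by rewrite Vminus_setC finset.in_setC => /negPf.
have mp u : u \in Vp -> (u \in Vm) = false.
  by rewrite Vminus_setC finset.in_setC => ->.
have cross : \sum_(u in Vp) \sum_(v in Vm) x u * smoothed_entry R E u v * x v =
    w_cross R E * (\sum_(u in Vp) x u) * (\sum_(u in Vm) x u).
  rewrite -mulrA mulr_suml mulr_sumr; apply: eq_bigr => u uP.
  rewrite !mulr_sumr; apply: eq_bigr => v vM; rewrite /smoothed_entry.
  have [uv | _] := eqVneq u v; first by rewrite uv (pm v vM) in uP.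
  by rewrite (pm v vM) (mp u uP) andbF /=; ring.
rewrite -!double_sum_offdiag /quadratic_form sum_Vplus_Vminus.
under eq_bigr => u _ do rewrite sum_Vplus_Vminus.
under [X in _ + X]eq_bigr => u _ do rewrite sum_Vplus_Vminus.
rewrite !big_split /= cross.
rewrite [X in _ + (X + _)]
  (_ : _ = w_cross R E * (\sum_(u in Vp) x u) * (\sum_(u in Vm) x u)).
  rewrite (eq_bigr (fun u =>
      \sum_(v in Vp) x u * (if u == v then 0 else w_plus R E) * x v)).
    rewrite [X in _ + (_ + X)](eq_bigr (fun u =>
        \sum_(v in Vm) x u * (if u == v then 0 else w_minus R E) * x v)).
      by ring.
    by move=> u uM; apply: eq_bigr => v vM; rewrite /smoothed_entry uM vM pm.
  by move=> u uP; apply: eq_bigr => v vP; rewrite /smoothed_entry uP vP.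
rewrite -cross exchange_big; apply: eq_bigr => u _; apply: eq_bigr => v _.
by rewrite smoothed_entryC; ring.
Qed.

(** Splitting all arcs into four blocks counts the crossing edges twice. As a cardinality, [m_cross]
    is nonnegative. *)
Lemma m_crossE : m_cross R E = (arcs E Vp Vm)%:R.
Proof.
have : (2 * #|edges E| = 2 * edges_in E Vp + 2 * edges_in E Vm + 2 * arcs E Vp Vm)%N.
  rewrite -edges_in_setT -!(arcs_diag Esym Eirr) Vminus_setC.
  rewrite (arcs_splitr _ _ Vp) !(arcsC Esym finset.setT) !(arcs_splitr _ _ Vp).
  by rewrite (arcsC Esym (~: Vp) Vp); lia.
move/(congr1 (fun k => k%:R : R)); rewrite !(natrM, natrD) /m_cross; lra.
Qed.

Lemma density_mul (S : {set V}) :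
  (edges_in E S)%:R / 'C(#|S|, 2)%:R * (#|S|%:R ^+ 2 - #|S|%:R) = 2 * (edges_in E S)%:R :> R.
Proof.
have bE : #|S|%:R ^+ 2 - #|S|%:R = 2 * 'C(#|S|, 2)%:R :> R.
  have := bin_ffact #|S| 2; case: #|S| => [_|k]; first by rewrite expr0n subrr mulr0.
  rewrite ffactnS ffactn1 /= => /(congr1 (fun k => k%:R : R)); rewrite !natrM -natr1; lra.
(* If the binomial is 0, the quotient defaults to 0, but then [S] also spans no edge. *)
have := edges_in_le Eirr S; rewrite bE; case: 'C(_, _) => [|k] h.
  by move: h; rewrite leqn0 => /eqP ->; rewrite !mul0r mulr0.
by rewrite mulrCA mulfVK // pnatr_eq0.
Qed.

Lemma edges_in_plusE :
  2 * (edges_in E Vp)%:R + m_cross R E = \sum_(u in Vp) (degree E u)%:R.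
Proof.
rewrite m_crossE -natr_sum -arcs_setT (arcs_splitr _ _ Vp) -Vminus_setC.
by rewrite (arcs_diag Esym Eirr) natrD natrM.
Qed.

Lemma edges_in_minusE :
  2 * (edges_in E Vm)%:R + m_cross R E = \sum_(u in Vm) (degree E u)%:R.
Proof.
have VmC : ~: Vm = Vp by rewrite Vminus_setC finset.setCK.
rewrite m_crossE -natr_sum -arcs_setT (arcs_splitr _ _ Vm) VmC.
by rewrite (arcs_diag Esym Eirr) natrD natrM (arcsC Esym Vp).
Qed.

Lemma block_formE (x : V -> R) (a b : R) :
  {in Vp, forall u, x u = a} -> {in Vm, forall u, x u = b} ->
  quadratic_form (fun u v => (E u v)%:R) x =
  2 * (edges_in E Vp)%:R * a ^+ 2 + 2 * (edges_in E Vm)%:R * b ^+ 2 +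
  2 * m_cross R E * a * b.
Proof.
move=> xa xb.
have sE (S T : {set V}) (e f : R) :
    {in S, forall u, x u = e} -> {in T, forall u, x u = f} ->
    \sum_(u in S) \sum_(v in T) x u * (E u v)%:R * x v = (arcs E S T)%:R * (e * f).
  move=> xe xf; rewrite natr_sum mulr_suml; apply: eq_bigr => u uS.
  rewrite natr_sum mulr_suml; apply: eq_bigr => v vT.
  by rewrite xe // xf //; ring.
rewrite /quadratic_form sum_Vplus_Vminus.
under eq_bigr => u _ do rewrite sum_Vplus_Vminus.
under [X in _ + X]eq_bigr => u _ do rewrite sum_Vplus_Vminus.
rewrite !big_split /= (sE _ _ _ _ xa xa) (sE _ _ _ _ xa xb).
rewrite (sE _ _ _ _ xb xa) (sE _ _ _ _ xb xb).
rewrite m_crossE (arcsC Esym Vm) !(arcs_diag Esym Eirr) !natrM; ring.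
Qed.

Lemma sum_block (x : V -> R) (a b : R) :
  {in Vp, forall u, x u = a} -> {in Vm, forall u, x u = b} ->
  \sum_u x u ^+ 2 = #|Vp|%:R * a ^+ 2 + #|Vm|%:R * b ^+ 2.
Proof.
by move=> xa xb; rewrite sum_Vplus_Vminus (sum_expr_const 2 xa) (sum_expr_const 2 xb).
Qed.

(** Density times number of pairs gives back the edge count, so the value agrees with [block_formE].
    Nonempty classes keep the denominator of [w_cross] nonzero. *)
Lemma smoothed_block_formE (x : V -> R) (a b : R) :
    (0 < #|Vp|)%N -> (0 < #|Vm|)%N ->
  {in Vp, forall u, x u = a} -> {in Vm, forall u, x u = b} ->
  quadratic_form (smoothed_entry R E) x =
  2 * (edges_in E Vp)%:R * a ^+ 2 + 2 * (edges_in E Vm)%:R * b ^+ 2 +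
  2 * m_cross R E * a * b.
Proof.
move=> p0 m0 xa xb.
rewrite smoothed_formE (sum_expr_const 1 xa) (sum_expr_const 1 xb).
rewrite (sum_expr_const 2 xa) (sum_expr_const 2 xb) !expr1.
rewrite -!density_mul -/(w_plus R E) -/(w_minus R E) /w_cross; field.
by rewrite !pnatr_eq0 -!lt0n p0 m0.
Qed.

Lemma sum_deviation : (0 < #|V|)%N -> \sum_u ((degree E u)%:R - d) = 0.
Proof.
move=> n0; rewrite sumrB sumr_const -mulr_natr mulfVK ?pnatr_eq0 -?lt0n //.
have := arcs_setT E finset.setT; rewrite (arcs_diag Esym Eirr) edges_in_setT.
rewrite (eq_bigl predT) => [/(congr1 (fun k => k%:R : R))|u]; last by rewrite inE.
by rewrite natrM natr_sum => ->; rewrite subrr.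
Qed.

(** The signed deviations sum to 0, so the positive ones contribute exactly half of [s]. *)
Lemma deviation_plus : (0 < #|V|)%N ->
  s = 2 * (\sum_(u in Vp) (degree E u)%:R - d * #|Vp|%:R).
Proof.
move=> n0; have := sum_deviation n0; rewrite /degree_deviation !sum_Vplus_Vminus.
rewrite [X in _ -> X + _ = _](eq_bigr (fun u => (degree E u)%:R - d)); last first.
  by move=> u; rewrite inE => du; rewrite gtr0_norm ?subr_gt0.
rewrite [X in _ -> _ + X = _](eq_bigr (fun u => - ((degree E u)%:R - d))); last first.
  by move=> u; rewrite inE => du; rewrite ler0_norm ?subr_le0.
by rewrite sumrN !sumrB !sumr_const -!(mulr_natr d); lra.
Qed.

Lemma deviation_minus : (0 < #|V|)%N ->
  s = 2 * (d * #|Vm|%:R - \sum_(u in Vm) (degree E u)%:R).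
Proof.
move=> n0; rewrite deviation_plus //; have := sum_deviation n0; rewrite sum_Vplus_Vminus.
by rewrite !sumrB !sumr_const -!(mulr_natr d); lra.
Qed.

Lemma smoothed_radius_le : (0 < #|Vp|)%N -> (0 < #|Vm|)%N ->
  smoothed_radius R E <= spectral_radius R E.
Proof.
move=> p0 m0; have V0 : (0 < #|V|)%N by apply: leq_trans p0 (max_card _).
have asym u v : (E u v)%:R = (E v u)%:R :> R by rewrite Esym.
have adj_le := quadratic_form_le V0 asym; rewrite -/(spectral_radius R E) in adj_le.
(* The constant vector 1 shows this; the sign is needed at the end to multiply the comparison of
   norms by the radius. *)
have radius0 : 0 <= spectral_radius R E.
  have := adj_le (fun=> 1).
  rewrite (eq_bigr (fun=> 1)) => [|u _]; last by rewrite expr1n.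
  rewrite sumr_const -(pmulr_lge0 _ (x := #|V|%:R)) ?ltr0n //; apply: le_trans.
  by do 2!(apply: sumr_ge0 => ? _); rewrite mul1r mulr1.
have [x x0 xE] := quadratic_form_max V0 smoothed_entryC.
rewrite -(ler_pM2r x0) -/(smoothed_radius R E) -[leLHS]xE {xE}.
pose sp := \sum_(u in Vp) x u; pose sm := \sum_(u in Vm) x u.
pose tp := \sum_(u in Vp) x u ^+ 2; pose tm := \sum_(u in Vm) x u ^+ 2.
pose a := sp / #|Vp|%:R; pose b := sm / #|Vm|%:R.
pose y u := if u \in Vp then a else b.
have ya : {in Vp, forall u, y u = a} by move=> u; rewrite /y => ->.
have yb : {in Vm, forall u, y u = b}.
  by move=> u; rewrite Vminus_setC finset.in_setC /y => /negPf ->.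
have tp_ge : #|Vp|%:R * a ^+ 2 <= tp.
  apply: le_trans (sqr_sum_le Vp x); rewrite le_eqVlt; apply/orP; left; apply/eqP.
  by rewrite /a -/sp; field; rewrite pnatr_eq0 -lt0n.
have tm_ge : #|Vm|%:R * b ^+ 2 <= tm.
  apply: le_trans (sqr_sum_le Vm x); rewrite le_eqVlt; apply/orP; left; apply/eqP.
  by rewrite /b -/sm; field; rewrite pnatr_eq0 -lt0n.
(* Averaging x over the two classes keeps its class sums and decreases the
   sums of squares, which the smoothed form counts negatively. *)
apply: (@le_trans _ _ (quadratic_form (smoothed_entry R E) y)).
  rewrite !smoothed_formE -/sp -/sm -/tp -/tm.
  rewrite (sum_expr_const 1 ya) (sum_expr_const 1 yb).
  rewrite (sum_expr_const 2 ya) (sum_expr_const 2 yb) !expr1.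
  have -> : #|Vp|%:R * a = sp by rewrite mulrC mulfVK // pnatr_eq0 -lt0n.
  have -> : #|Vm|%:R * b = sm by rewrite mulrC mulfVK // pnatr_eq0 -lt0n.
  by rewrite lerD2r lerD // ler_wpM2l ?divr_ge0 ?ler0n // lerB.
(* On [y], constant on each class, the smoothed form equals the adjacency form. *)
rewrite (smoothed_block_formE p0 m0 ya yb) -(block_formE ya yb).
apply: le_trans (adj_le y) _; rewrite ler_wpM2l // (sum_block ya yb).
by rewrite [leRHS]sum_Vplus_Vminus lerD.
Qed.
End Smoothed.

(** * Assembly of the two inequalities *)

Theorem theorem2 (R : realType) (V : finType) (E : rel V)
    (Esym : symmetric E) (Eirr : irreflexive E) :
  let n : R := #|V|%:R in
  let d : R := avg_degree R E in
  let s : R := degree_deviation R E in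
  0 < s ->
  smoothed_radius R E <= spectral_radius R E /\
  (if s <= d * n / Num.sqrt 2
   then d ^+ 2 * n / Num.sqrt (d ^+ 2 * n ^+ 2 - s ^+ 2)
   else 2 * s / n) <= smoothed_radius R E.
Proof.
move=> n d s s0.
have V0 : (0 < #|V|)%N.
  rewrite lt0n; apply: contraTneq s0 => /card0_eq V0.
  by rewrite -leNgt /s /degree_deviation big1 // => u; have := V0 u.
have sp := deviation_plus R Esym Eirr V0; have sm := deviation_minus R Esym Eirr V0.
(* Each class carries half of the deviation, so an empty class would force [s = 0]. *)
have p0 : (0 < #|Vplus R E|)%N.
  rewrite card_gt0; apply: contraTneq s0 => p0.
  by rewrite /s sp p0 big_set0 cards0 mulr0 subrr mulr0 ltxx.
have m0 : (0 < #|Vminus R E|)%N.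
  rewrite card_gt0; apply: contraTneq s0 => m0.
  by rewrite /s sm m0 big_set0 cards0 mulr0 subrr mulr0 ltxx.
split; first exact: smoothed_radius_le.
have ep := edges_in_plusE R Esym Eirr; have em := edges_in_minusE R Esym Eirr.
have ep0 : 0 <= (edges_in E (Vplus R E))%:R :> R by [].
have em0 : 0 <= (edges_in E (Vminus R E))%:R :> R by [].
rewrite -/s -/d -ep in sp; rewrite -/s -/d -em in sm.
set q := #|Vplus R E|%:R in sp; set p := #|Vminus R E|%:R in sm.
set c := m_cross R E in sp sm *.
have c0 : 0 <= c by rewrite /c m_crossE.
have nE : n = p + q by rewrite addrC -card_Vplus_Vminus.
have p_gt0 : 0 < p by rewrite ltr0n.
have q_gt0 : 0 < q by rewrite ltr0n.
have sE : s = 2 * (s / 2) by lra.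
have S0 : 0 < s / 2 by lra.
have cp : c <= d * p - s / 2 by lra.
have cq : c <= s / 2 + d * q by lra.
set mu := if _ then _ else _.
have [a [b [N0 form_ge]]] : exists a b : R, 0 < q * a ^+ 2 + p * b ^+ 2 /\
    mu * (q * a ^+ 2 + p * b ^+ 2) <= (s / 2 + d * q - c) * a ^+ 2 +
      (d * p - s / 2 - c) * b ^+ 2 + 2 * c * a * b.
  rewrite /mu; case: ifP => [s_le | _]; last exact: two_block_large.
  exact: two_block_small.
pose y u := if u \in Vplus R E then a else b.
have ya : {in Vplus R E, forall u, y u = a} by move=> u; rewrite /y => ->.
have yb : {in Vminus R E, forall u, y u = b}.
  by move=> u; rewrite Vminus_setC finset.in_setC /y => /negPf ->.
rewrite -(ler_pM2r N0); apply: le_trans form_ge _.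
have := quadratic_form_le V0 (@smoothed_entryC R V E) y.
rewrite (smoothed_block_formE Eirr p0 m0 ya yb) (sum_block ya yb) -/q -/p -/c.
rewrite -/(smoothed_radius R E).
(* The degree sums inside [sp] and [sm] identify the coefficients of the two-class form with doubled
   edge counts. *)
have <- : 2 * (edges_in E (Vplus R E))%:R = s / 2 + d * q - c by lra.
by have <- : 2 * (edges_in E (Vminus R E))%:R = d * p - s / 2 - c by lra.
Qed.
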